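(* Let $\nu_1,\nu_2\ge 0$ and let $\mathcal{L}_n^{(\nu_1,\nu_2)}$ ($n\ge 1$) be the Stancu type operators including generalized Brenke polynomials associated with $A_1,A_2,h$ as in the context. Assume $$\lim_{y\to\infty}\frac{A_2'(y)}{A_2(y)}=1\quad\text{and}\quad \lim_{y\to\infty}\frac{A_2''(y)}{A_2(y)}=1 .$$ Let $f:[0,\infty)\to\mathbb{R}$ be a continuous function belonging to the class $E$, i.e. such that $\frac{f(x)}{1+x^2}$ is convergent as $x\to\infty$. Then $$\mathcal{L}_n^{(\nu_1,\nu_2)}(f;x)\to f(x)\quad\text{as } n\to\infty,$$ uniformly on each compact subset of $[0,\infty)$.
   Context: Setting. Let $R>1$. Let $A_1,A_2:\mathbb{R}\to(0,\infty)$ and $h$ be functions, analytic on $\{t:|t|<R\}$ with (real) power series expansions convergent for $|t|<R$: $A_1(t)=\sum_{k\ge0}a_{1,k}t^k$ with $a_{1,0}\neq0$; $A_2(t)=\sum_{k\ge0}a_{2,k}t^k$ with $a_{2,k}\ne0$ for all $k$; $h(t)=\sum_{k\ge1}h_kt^k$ with $h_1\neq0$. The generalized Brenke polynomials $\pi_k$ ($k\ge 0$) are the polynomials with $$A_1(h(t))\,A_2(xh(t))=\sum_{k=0}^\infty \pi_k(x)t^k ,$$ where the series converges and the identity holds for real $t$ with $|t|<R$ and every $x\in[0,\infty)$. It is assumed that $h'(1)=1$ and $\pi_k(x)\ge0$ for all $k\ge0$ and $x\in[0,\infty)$. Operators. For $\nu_1,\nu_2\ge0$, $n\ge1$, $x\in[0,\infty)$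 and $f:[0,\infty)\to\mathbb{R}$ (for which the series converges), $$\mathcal{L}_n^{(\nu_1,\nu_2)}(f;x)=\frac{1}{A_1(h(1))A_2(nxh(1))}\sum_{k=0}^\infty\pi_k(nx)\,f\!\left(\frac{k+\nu_1}{n+\nu_2}\right).$$ Primes denote derivatives. $E$ is the set of functions $f$ on $[0,\infty)$ for which $f(x)/(1+x^2)$ converges (to a finite limit) as $x\to\infty$. *)

(* Defs.v *)
From Stdlib Require Export Reals.
From Coquelicot Require Export Coquelicot.

Open Scope R_scope.

Definition polynomial_fun (p : R -> R) : Prop :=
  exists (d : nat) (c : nat -> R), forall x : R, p x = sum_n (fun j => c j * x ^ j) d.

(* [A1], [A2] and [h] are total functions, but their power series are required
   to converge to them on (-r, r) only.  [A2] nevertheless has all its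
   derivatives on (0, +oo): the identity [gb_generating] makes
   t |-> A2 (x * h t) analytic near t = 1 for every x > 0, and h'(1) = 1. *)
Record generalized_brenke (r : R) (A1 A2 h : R -> R) (a1 a2 hc : nat -> R)
    (p : nat -> R -> R) : Prop := {
  gb_radius : 1 < r;
  gb_A1_pos : forall t : R, 0 < A1 t;
  gb_A2_pos : forall t : R, 0 < A2 t;
  gb_A1_series : forall t : R, Rabs t < r -> is_pseries a1 t (A1 t);
  gb_A2_series : forall t : R, Rabs t < r -> is_pseries a2 t (A2 t);
  gb_h_series : forall t : R, Rabs t < r -> is_pseries hc t (h t);
  gb_a1_0 : a1 0%nat <> 0;
  gb_a2 : forall k : nat, a2 k <> 0;
  gb_hc_0 : hc 0%nat = 0;
  gb_hc_1 : hc 1%nat <> 0;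
  gb_poly : forall k : nat, polynomial_fun (p k);
  gb_generating : forall x t : R, 0 <= x -> Rabs t < r ->
    is_pseries (fun k => p k x) t (A1 (h t) * A2 (x * h t));
  gb_dh_1 : is_derive h 1 1;
  gb_p_nonneg : forall (k : nat) (x : R), 0 <= x -> 0 <= p k x
}.

Definition stancu_term (p : nat -> R -> R) (nu1 nu2 : R) (n : nat)
    (f : R -> R) (x : R) (k : nat) : R :=
  p k (INR n * x) * f ((INR k + nu1) / (INR n + nu2)).

Definition stancu_op (A1 A2 h : R -> R) (p : nat -> R -> R) (nu1 nu2 : R)
    (n : nat) (f : R -> R) (x : R) : R :=
  1 / (A1 (h 1) * A2 (INR n * x * h 1)) * Series (stancu_term p nu1 nu2 n f x).

(* Functions on [0, +oo) are restrictions of total functions; only their values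
   on [0, +oo) matter. *)
Definition class_E (f : R -> R) : Prop :=
  ex_finite_lim (fun x => f x / (1 + x ^ 2)) p_infty.

Definition unif_cv_on (K : R -> Prop) (u : nat -> R -> R) (f : R -> R) : Prop :=
  forall eps : posreal, exists N : nat, forall (n : nat) (x : R),
    (N <= n)%nat -> K x -> Rabs (u n x - f x) < eps.

(* Main.v *)
(* Put y = n x and G(t) = A1(h(t)) A2(y h(t)) = sum_k p_k(y) t^k.  Since p_k >= 0, the operator
   is the expectation of f((k + nu1) / (n + nu2)) for the probability weights p_k(y) / G(1),
   whose exponential moments are E[exp(s k / n)] = G(exp(s / n)) / G(1).  The function
   ln A2 - id has derivative A2'/A2 - 1 -> 0 and h'(1) = 1, so these moments tend to exp(s x),
   uniformly for x in [0, M].  As v^2 <= 4 (exp v + exp(- v) - 2), taking s = 1 and s = -1 gives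
   E[(k/n - x)^2] -> 0 uniformly, and Korovkin's argument concludes.  Exponential moments, unlike
   the first two moments, do not involve second derivatives of A2. *)

Require Import Defs.
From Stdlib Require Import Reals Ranalysis5 Lra Lia.
From Coquelicot Require Import Coquelicot.
Open Scope R_scope.

(** * Power series inside their disc, and difference quotients *)

(** At the midpoint [s] of [Rabs t] and [r] the series converges, so its terms tend to 0; a radius
    at most [Rabs t] would forbid this. *)
Lemma cv_radius_gt (r : R) (a : nat -> R) (f : R -> R) :
  (forall t : R, Rabs t < r -> is_pseries a t (f t)) ->
  forall t : R, Rabs t < r -> Rbar_lt (Rabs t) (CV_radius a).
Proof.
intros Ha t Ht.
set (s := (Rabs t + r) / 2).
assert (Hs : Rabs s = s).
{ apply Rabs_pos_eq; unfold s; pose proof (Rabs_pos t); lra. }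
assert (Hsr : Rabs s < r) by (rewrite Hs; unfold s; lra).
destruct (Rbar_lt_dec (Rabs t) (CV_radius a)) as [H | H]; [exact H |].
exfalso; apply (CV_disk_outside a s).
- apply Rbar_le_lt_trans with (Rabs t).
  + apply Rbar_not_lt_le; exact H.
  + rewrite Hs; simpl; unfold s; lra.
- apply (ex_series_lim_0 (fun n => a n * s ^ n)).
  exists (f s); apply is_pseries_R, Ha, Hsr.
Qed.

Lemma is_derive_pseries (r : R) (a : nat -> R) (f : R -> R) :
  (forall t : R, Rabs t < r -> is_pseries a t (f t)) ->
  forall t : R, Rabs t < r -> is_derive f t (PSeries (PS_derive a) t).
Proof.
intros Ha t Ht.
apply (is_derive_ext_loc (PSeries a)).
- assert (Hd : 0 < r - Rabs t) by lra.
  exists (mkposreal _ Hd); intros u Hu; simpl in u.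
  apply is_pseries_unique, Ha.
  change (Rabs (u - t) < r - Rabs t) in Hu.
  pose proof (Rabs_triang (u - t) t) as Htri.
  replace (u - t + t) with u in Htri by (simpl in *; ring).
  lra.
- apply is_derive_PSeries, (cv_radius_gt r a f Ha t Ht).
Qed.

Lemma ex_derive_continuity_pt (f : R -> R) (x : R) : ex_derive f x -> continuity_pt f x.
Proof.
intros H; apply continuity_pt_filterlim; exact (ex_derive_continuous f x H).
Qed.

(** The multiplied-out difference quotient allows [u = 0] and yields the two-sided bounds on [h]
    used in the intermediate value arguments. *)
Lemma is_derive_linear_bound (f : R -> R) (x l eps : R) :
  is_derive f x l -> 0 < eps ->
  exists delta, 0 < delta /\ forall u : R, Rabs u < delta ->
    Rabs (f (x + u) - f x - l * u) <= eps * Rabs u.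
Proof.
intros H Heps; apply is_derive_Reals in H.
destruct (H eps Heps) as [delta Hd].
exists delta; split; [apply cond_pos |].
intros u Hu; destruct (Req_dec u 0) as [-> | Hu0].
- rewrite Rplus_0_r, Rabs_R0, Rmult_0_r, Rmult_0_r, Rminus_0_r, Rminus_diag, Rabs_R0; lra.
- replace (f (x + u) - f x - l * u) with (((f (x + u) - f x) / u - l) * u)
    by (field; exact Hu0).
  rewrite Rabs_mult; apply Rmult_le_compat_r; [apply Rabs_pos |].
  apply Rlt_le, Hd; assumption.
Qed.

(* No injectivity of [h] is needed: by the intermediate value theorem every [s] near
   [h t0] is some [h t] with [|t - t0| <= 2 |s - h t0|]. *)
Lemma is_derive_of_comp (phi h : R -> R) (t0 m d : R) :
  0 < d -> (forall t, Rabs (t - t0) < d -> continuity_pt h t) ->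
  is_derive h t0 1 -> is_derive (fun t => phi (h t)) t0 m ->
  is_derive phi (h t0) m.
Proof.
intros Hd Hc Hh Hphi; apply is_derive_Reals; intros eps Heps.
pose proof (Rabs_pos m) as Hm.
(* The bound [1 / 2] gives [Rabs t <= 2 * Rabs s]; the other makes the final error at most
   [eps / 2 * Rabs s]. *)
set (e := Rmin (1 / 2) (eps / (4 * (1 + Rabs m)))).
assert (He : 0 < e).
{ apply Rmin_glb_lt; [lra |]; apply Rdiv_lt_0_compat; lra. }
assert (He2 : e <= 1 / 2) by apply Rmin_l.
assert (Hee : e * (1 + Rabs m) <= eps / 4).
{ apply Rle_trans with (eps / (4 * (1 + Rabs m)) * (1 + Rabs m)).
  - apply Rmult_le_compat_r; [lra | apply Rmin_r].
  - right; field; lra. }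
destruct (is_derive_linear_bound _ _ _ e Hh He) as (d1 & Hd1 & B1).
destruct (is_derive_linear_bound _ _ _ e Hphi He) as (d2 & Hd2 & B2).
set (eta := Rmin d (Rmin d1 d2) / 2).
assert (Heta : 0 < eta /\ eta < d /\ eta < d1 /\ eta < d2).
{ unfold eta; pose proof (Rmin_l d (Rmin d1 d2)); pose proof (Rmin_r d (Rmin d1 d2)).
  pose proof (Rmin_l d1 d2); pose proof (Rmin_r d1 d2).
  assert (0 < Rmin d (Rmin d1 d2)) by (repeat apply Rmin_glb_lt; assumption).
  lra. }
destruct Heta as (E0 & E1 & E2 & E3).
assert (Heta2 : 0 < eta / 2) by lra.
(* At [t0 - eta] and [t0 + eta], [h] has moved from [h t0] by at least [eta / 2] in opposite
   directions, so [h t0 + s] is bracketed. *)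
exists (mkposreal _ Heta2); simpl; intros s Hs0 Hs.
apply Rabs_def2 in Hs.
destruct (IVT_interv (fun u => h u - (h t0 + s)) (t0 - eta) (t0 + eta)) as (t' & Ht' & Hht').
- intros u Hu; apply (continuity_pt_minus h (fun _ => h t0 + s)).
  + apply Hc, Rabs_def1; lra.
  + apply continuity_pt_const; intros ? ?; reflexivity.
- lra.
- specialize (B1 (- eta)); rewrite Rabs_Ropp, Rabs_pos_eq in B1 by lra.
  specialize (B1 E2); apply Rabs_le_between in B1.
  replace (t0 - eta) with (t0 + - eta) by ring; nra.
- specialize (B1 eta); rewrite Rabs_pos_eq in B1 by lra.
  specialize (B1 E2); apply Rabs_le_between in B1; nra.
- set (t := t' - t0).
  assert (Ht : Rabs t <= eta) by (apply Rabs_le; unfold t; lra).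
  specialize (B1 t ltac:(lra)); specialize (B2 t ltac:(lra)); simpl in B2.
  replace (t0 + t) with t' in B1, B2 by (unfold t; ring).
  replace (h t') with (h t0 + s) in B1, B2 by lra.
  replace (h t0 + s - h t0 - 1 * t) with (s - t) in B1 by ring.
  assert (Hts : Rabs t <= 2 * Rabs s).
  { pose proof (Rabs_triang (t - s) s) as T.
    replace (t - s + s) with t in T by ring.
    rewrite (Rabs_minus_sym t s) in T.
    pose proof (Rabs_pos t); nra. }
  replace ((phi (h t0 + s) - phi (h t0)) / s - m)
    with ((phi (h t0 + s) - phi (h t0) - m * s) / s) by (field; exact Hs0).
  rewrite Rabs_div by exact Hs0.
  pose proof (Rabs_pos_lt s Hs0) as Hsp.
  apply Rmult_lt_reg_r with (Rabs s); [exact Hsp |].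
  unfold Rdiv; rewrite Rmult_assoc, Rinv_l, Rmult_1_r by lra.
  replace (phi (h t0 + s) - phi (h t0) - m * s)
    with ((phi (h t0 + s) - phi (h t0) - m * t) + (- m) * (s - t)) by ring.
  eapply Rle_lt_trans; [apply Rabs_triang |].
  rewrite Rabs_mult, Rabs_Ropp.
  assert (Rabs m * Rabs (s - t) <= Rabs m * (e * Rabs t))
    by (apply Rmult_le_compat_l; assumption).
  assert (e * (1 + Rabs m) * Rabs t <= eps / 4 * (2 * Rabs s)).
  { apply Rmult_le_compat; try assumption; [nra | apply Rabs_pos]. }
  nra.
Qed.

(** * Positivity of [h 1] and differentiability of [A2] on the half-line *)

Lemma is_series_term_le (a : nat -> R) (l : R) :
  (forall k, 0 <= a k) -> is_series a l -> forall k, a k <= l.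
Proof.
intros Ha Hl k; apply Rle_trans with (sum_n a k).
- destruct k as [| k]; [rewrite sum_O; apply Rle_refl |].
  rewrite sum_Sn; change (a (S k) <= sum_n a k + a (S k)).
  assert (0 <= sum_n a k); [| lra].
  induction k as [| k IH]; [rewrite sum_O; apply Ha |].
  rewrite sum_Sn; apply Rplus_le_le_0_compat; [exact IH | apply Ha].
- apply (is_lim_seq_incr_compare (sum_n a)); [exact Hl |].
  intros n; rewrite sum_Sn; change (sum_n a n <= sum_n a n + a (S n)).
  pose proof (Ha (S n)); lra.
Qed.

(* [h 1 <= 0] would give [h t1 = h 1] for some [0 <= t1 < 1]; as [p k x >= 0], the
   generating function would be constant in [t], and so would [A2 o h], whose derivative
   at [0] is [a2 1 * hc 1 <> 0]. *)
Lemma brenke_h1_pos (r : R) (A1 A2 h : R -> R) (a1 a2 hc : nat -> R) (p : nat -> R -> R) :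
  generalized_brenke r A1 A2 h a1 a2 hc p -> 0 < h 1.
Proof.
intros Hp; destruct (Rlt_dec 0 (h 1)) as [| Hneg]; [assumption | exfalso].
apply Rnot_lt_le in Hneg.
pose proof (gb_radius _ _ _ _ _ _ _ _ Hp) as Hr.
pose proof (gb_A1_pos _ _ _ _ _ _ _ _ Hp) as HA1.
pose proof (gb_A2_pos _ _ _ _ _ _ _ _ Hp) as HA2.
assert (Hdh : forall t, Rabs t < r -> is_derive h t (PSeries (PS_derive hc) t))
  by (intros; apply (is_derive_pseries r); [apply (gb_h_series _ _ _ _ _ _ _ _ Hp) | assumption]).
assert (R0 : Rabs 0 < r) by (rewrite Rabs_R0; lra).
assert (R1 : Rabs 1 < r) by (rewrite Rabs_R1; lra).
assert (h0 : h 0 = 0).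
{ rewrite <- (is_pseries_unique _ _ _ (gb_h_series _ _ _ _ _ _ _ _ Hp 0 R0)).
  rewrite PSeries_0; apply (gb_hc_0 _ _ _ _ _ _ _ _ Hp). }
assert (Ht1 : exists t1, 0 <= t1 < 1 /\ h t1 = h 1).
(* If [h 1 = 0], then [t1 = 0] serves. Otherwise the slope 1 at 1 gives [h (1 - u) < h 1 < h 0] for
   a small [u > 0], and [h] takes the value [h 1] in between. *)
{ destruct (Rle_lt_or_eq_dec _ _ Hneg) as [Hlt | Heq]; [| exists 0; split; lra].
  assert (Hhalf : 0 < 1 / 2) by lra.
  destruct (is_derive_linear_bound _ _ _ _ (gb_dh_1 _ _ _ _ _ _ _ _ Hp) Hhalf)
    as (d & Hd & B).
  set (u := Rmin d 1 / 2).
  assert (Hu : 0 < u < d /\ u <= 1 / 2).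
  { unfold u; pose proof (Rmin_l d 1); pose proof (Rmin_r d 1).
    assert (0 < Rmin d 1) by (apply Rmin_glb_lt; lra); lra. }
  specialize (B (- u)); rewrite Rabs_Ropp, Rabs_pos_eq in B by lra.
  specialize (B ltac:(lra)); apply Rabs_le_between in B.
  destruct (IVT_interv (fun t => h 1 - h t) 0 (1 + - u)) as (t1 & Ht1 & Hh1); try lra.
  - intros t Ht; apply (continuity_pt_minus (fun _ => h 1) h).
    + apply continuity_pt_const; intros ? ?; reflexivity.
    + apply ex_derive_continuity_pt; eexists; apply Hdh; rewrite Rabs_pos_eq; lra.
  - exists t1; lra. }
destruct Ht1 as (t1 & Ht1 & Hh1).
assert (Hpk : forall x k, 0 <= x -> p (S k) x = 0).
{ intros x k Hx.
  assert (Rt1 : Rabs t1 < r) by (rewrite Rabs_pos_eq; lra).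
  pose proof (proj1 (is_pseries_R _ _ _) (gb_generating _ _ _ _ _ _ _ _ Hp x 1 Hx R1)) as S1.
  pose proof (proj1 (is_pseries_R _ _ _) (gb_generating _ _ _ _ _ _ _ _ Hp x t1 Hx Rt1)) as S2.
  rewrite Hh1 in S2; clear Hh1.
  (* Both series have the same sum, so the nonnegative differences [p j x * (1 - t1 ^ j)] add up to
     0 and each vanishes; [t1 ^ j < 1] holds only from [j = 1] on. *)
  assert (S3 : is_series (fun j => p j x * 1 ^ j - p j x * t1 ^ j) 0).
  { rewrite <- (Rminus_diag (A1 (h 1) * A2 (x * h 1))).
    exact (is_series_minus _ _ _ _ S1 S2). }
  assert (Hpos : forall j, 0 <= p j x * 1 ^ j - p j x * t1 ^ j).
  { intros j; rewrite pow1.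
    assert (t1 ^ j <= 1) by (rewrite <- (pow1 j); apply pow_incr; lra).
    pose proof (gb_p_nonneg _ _ _ _ _ _ _ _ Hp j x Hx); nra. }
  assert (Hle : p (S k) x * 1 ^ S k - p (S k) x * t1 ^ S k <= 0).
  { exact (is_series_term_le _ _ Hpos S3 (S k)). }
  assert (t1 ^ S k < 1).
  { simpl; assert (0 <= t1 ^ k <= 1) by (split; [apply pow_le; lra |
      rewrite <- (pow1 k); apply pow_incr; lra]); nra. }
  rewrite pow1 in Hle.
  pose proof (gb_p_nonneg _ _ _ _ _ _ _ _ Hp (S k) x Hx); nra. }
assert (HG : forall x t, 0 <= x -> Rabs t < r -> A1 (h t) * A2 (x * h t) = p 0%nat x).
{ intros x t Hx Ht.
  rewrite <- (is_pseries_unique _ _ _ (gb_generating _ _ _ _ _ _ _ _ Hp x t Hx Ht)).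
  unfold PSeries; rewrite Series_incr_1.
  - rewrite (Series_ext _ (fun _ => 0 * 0)) by (intros k; rewrite Hpk by exact Hx; ring).
    rewrite Series_scal_l; simpl; ring.
  - eexists; apply (proj1 (is_pseries_R _ _ _) (gb_generating _ _ _ _ _ _ _ _ Hp x t Hx Ht)). }
(* At [x = 0] the identity makes [A1 (h t)] constant; at [x = 1] it then does so for [A2 (h t)]. *)
assert (Hconst : forall t, Rabs t < r -> A2 (h t) = A2 0).
{ intros t Ht.
  pose proof (HG 0 t (Rle_refl _) Ht) as G0t; pose proof (HG 0 0 (Rle_refl _) R0) as G00.
  pose proof (HG 1 t Rle_0_1 Ht) as G1t; pose proof (HG 1 0 Rle_0_1 R0) as G10.
  rewrite h0, ?Rmult_0_l, ?Rmult_0_r, ?Rmult_1_l in *.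
  pose proof (HA1 0); pose proof (HA2 0).
  assert (A1 (h t) = A1 0) by (apply Rmult_eq_reg_r with (A2 0); lra).
  apply Rmult_eq_reg_l with (A1 0); [| lra]. congruence. }
assert (HdA : is_derive A2 (h 0) (PSeries (PS_derive a2) 0)).
{ rewrite h0; apply (is_derive_pseries r);
    [apply (gb_A2_series _ _ _ _ _ _ _ _ Hp) | assumption]. }
pose proof (is_derive_comp A2 h 0 _ _ HdA (Hdh 0 R0)) as D1.
assert (D2 : is_derive (fun t => A2 (h t)) 0 0).
{ apply (is_derive_ext_loc (fun _ => A2 0)); [| exact (@is_derive_const R_AbsRing R_NormedModule (A2 0) 0)].
  assert (Hr0 : 0 < r) by lra.
  exists (mkposreal _ Hr0); intros t Ht; symmetry; apply Hconst.
  change (Rabs (t - 0) < r) in Ht; rewrite Rminus_0_r in Ht; exact Ht. }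
pose proof (is_derive_unique _ _ _ D1) as E1; rewrite (is_derive_unique _ _ _ D2) in E1.
rewrite !PSeries_0 in E1; unfold PS_derive, scal in E1; simpl in E1; unfold mult in E1.
simpl in E1.
pose proof (gb_a2 _ _ _ _ _ _ _ _ Hp 1%nat); pose proof (gb_hc_1 _ _ _ _ _ _ _ _ Hp).
symmetry in E1; apply Rmult_integral in E1; lra.
Qed.

(** The series of [a2] controls [A2] only on [(-r, r)] and serves at [z = 0]. For [z > 0] and
    [y = z / h 1], dividing the generating identity at [x = y] by the one at [x = 0] cancels [A1];
    so [A2 (y * h t)] is differentiable in [t] at 1, and [is_derive_of_comp] removes [h]. *)
Lemma brenke_A2_derivable (r : R) (A1 A2 h : R -> R) (a1 a2 hc : nat -> R)
    (p : nat -> R -> R) (z : R) :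
  generalized_brenke r A1 A2 h a1 a2 hc p -> 0 <= z -> ex_derive A2 z.
Proof.
intros Hp Hz.
pose proof (gb_radius _ _ _ _ _ _ _ _ Hp) as Hr.
pose proof (gb_A1_pos _ _ _ _ _ _ _ _ Hp) as HA1.
pose proof (gb_A2_pos _ _ _ _ _ _ _ _ Hp) as HA2.
pose proof (brenke_h1_pos _ _ _ _ _ _ _ _ Hp) as Hh1.
assert (R1 : Rabs 1 < r) by (rewrite Rabs_R1; lra).
destruct (Rle_lt_or_eq_dec _ _ Hz) as [Hz0 | <-].
2: { eexists; apply (is_derive_pseries r a2);
       [apply (gb_A2_series _ _ _ _ _ _ _ _ Hp) | rewrite Rabs_R0; lra]. }
assert (HdG : forall x, 0 <= x -> ex_derive (fun t => A1 (h t) * A2 (x * h t)) 1).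
{ intros x Hx; eexists.
  apply (is_derive_pseries r (fun k => p k x) (fun t => A1 (h t) * A2 (x * h t)));
    [intros; apply (gb_generating _ _ _ _ _ _ _ _ Hp); assumption | exact R1]. }
set (y := z / h 1).
assert (Hy : 0 < y) by (apply Rdiv_lt_0_compat; assumption).
assert (HdA : ex_derive (fun t => A2 (y * h t)) 1).
{ apply (ex_derive_ext
    (fun t => A2 0 * (A1 (h t) * A2 (y * h t)) / (A1 (h t) * A2 (0 * h t)))).
  - intros t; simpl; rewrite Rmult_0_l; pose proof (HA1 (h t)); pose proof (HA2 0).
    field; lra.
  - apply ex_derive_div.
    + apply ex_derive_scal, HdG; lra.
    + apply HdG; lra.
    + apply Rgt_not_eq, Rmult_lt_0_compat; [apply HA1 | apply HA2]. }
destruct HdA as [m Hm].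
assert (Hd : is_derive (fun u => A2 (y * u)) (h 1) m).
{ apply (is_derive_of_comp _ h 1 m (r - 1)); [lra | | apply (gb_dh_1 _ _ _ _ _ _ _ _ Hp) | exact Hm].
  intros t Ht; apply ex_derive_continuity_pt; eexists.
  apply (is_derive_pseries r hc); [apply (gb_h_series _ _ _ _ _ _ _ _ Hp) |].
  pose proof (Rabs_triang (t - 1) 1) as T; replace (t - 1 + 1) with t in T by ring.
  rewrite Rabs_R1 in T; lra. }
apply (ex_derive_ext (fun w => A2 (y * (w / y)))).
- intros w; f_equal; field; lra.
- apply (ex_derive_comp (fun u => A2 (y * u)) (fun w => w / y)).
  + exists m; replace (z / y) with (h 1) by (unfold y; field; lra); exact Hd.
  + auto_derive; exact I.
Qed.

(** * Limits of the exponential moments *)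

(* Where [INR n * x] is large the increment is controlled by the decay of [Derive L], since
   the two arguments stay at bounded distance; elsewhere they range over a fixed compact
   interval and get arbitrarily close. *)
Lemma increment_cv_0 (L : R -> R) (c s M : R) (cn : nat -> R) :
  (forall z, 0 <= z -> ex_derive L z) -> is_lim (Derive L) p_infty 0 ->
  0 < c -> 0 <= M -> is_lim_seq (fun n => INR n * (cn n - c)) s ->
  forall eps : R, 0 < eps -> exists N : nat, forall (n : nat) (x : R), (N <= n)%nat ->
    0 <= x <= M -> Rabs (L (INR n * x * cn n) - L (INR n * x * c)) < eps.
Proof.
intros Hd Hlim Hc HM Hcn eps Heps.
(* Eventually [INR n * Rabs (cn n - c) <= S], so the two arguments differ by at most [M * S]. *)
set (S := Rabs s + 1).
assert (HS : 0 < S) by (unfold S; pose proof (Rabs_pos s); lra).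
assert (HMS : 0 <= M * S) by (apply Rmult_le_pos; lra).
assert (He : 0 < eps / (M * S + 1)) by (apply Rdiv_lt_0_compat; lra).
apply is_lim_spec in Hlim; destruct (Hlim (mkposreal _ He)) as [K0 HK0]; simpl in HK0.
set (K := Rmax K0 0 + 1).
assert (HK : 0 < K /\ K0 < K)
  by (unfold K; pose proof (Rmax_l K0 0); pose proof (Rmax_r K0 0); lra).
(* As [cn n >= c / 2], [y >= Y] puts both arguments at or beyond [K]; as [cn n <= 2 * c], [y < Y]
   leaves them in [[0, 2 * (Y * c)]], where uniform continuity applies. *)
set (Y := 2 * K / c).
assert (HY : 0 < Y) by (apply Rdiv_lt_0_compat; lra).
assert (HYc : Y * c = 2 * K) by (unfold Y; field; lra).
destruct (Heine L _ (compact_P3 0 (2 * (Y * c)))) with (eps := mkposreal _ Heps)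
  as [delta Hdelta].
{ intros z [Hz _]; apply ex_derive_continuity_pt, Hd, Hz. }
simpl in Hdelta.
(* The first bound on [Rabs (cn n - c)] confines [cn n] to [[c / 2, 2 * c]]; the second keeps the
   arguments within [delta] of each other when [y < Y]. *)
set (m := Rmin (c / 2) (delta / Y)).
assert (Hm : 0 < m) by (apply Rmin_glb_lt; [lra | apply Rdiv_lt_0_compat; [apply cond_pos | lra]]).
apply is_lim_seq_spec in Hcn; destruct (Hcn (mkposreal 1 Rlt_0_1)) as [N1 HN1]; simpl in HN1.
destruct (INR_unbounded (S / m)) as [N2 HN2].
exists (Nat.max N1 N2); intros n x Hn Hx.
assert (HnS : INR n * Rabs (cn n - c) <= S).
{ specialize (HN1 n ltac:(lia)).
  rewrite <- (Rabs_pos_eq (INR n)) at 1 by apply pos_INR.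
  rewrite <- Rabs_mult.
  pose proof (Rabs_triang_inv (INR n * (cn n - c)) s); unfold S; lra. }
assert (Hnn : S / m < INR n).
{ apply Rlt_le_trans with (INR N2); [exact HN2 | apply le_INR; lia]. }
assert (HnSm : S < INR n * m).
{ apply Rmult_lt_compat_r with (r := m) in Hnn; [| exact Hm].
  replace (S / m * m) with S in Hnn by (field; lra); exact Hnn. }
assert (Hnpos : 0 < INR n).
{ apply Rle_lt_trans with (S / m); [apply Rlt_le, Rdiv_lt_0_compat; assumption | exact Hnn]. }
assert (Hcm : Rabs (cn n - c) < m).
{ apply Rmult_lt_reg_l with (INR n); lra. }
assert (Hcb : c / 2 <= cn n <= 2 * c).
{ assert (m <= c / 2) by apply Rmin_l.
  apply Rabs_def2 in Hcm; lra. }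
assert (HcY : Y * Rabs (cn n - c) < delta).
{ assert (m <= delta / Y) by apply Rmin_r.
  apply Rlt_le_trans with (Y * (delta / Y)); [apply Rmult_lt_compat_l; lra |].
  right; field; lra. }
set (y := INR n * x).
assert (Hy0 : 0 <= y) by (apply Rmult_le_pos; lra).
destruct (Rle_lt_dec Y y) as [HYy | HyY].
- assert (Hy1 : K <= y * cn n) by nra.
  assert (Hy2 : K <= y * c) by nra.
  assert (Hmin : K <= Rmin (y * c) (y * cn n)) by (apply Rmin_glb; assumption).
  destruct (MVT_gen L (y * c) (y * cn n) (Derive L)) as (z & Hz & ->).
  + intros z Hz; apply Derive_correct, Hd; lra.
  + intros z Hz; apply ex_derive_continuity_pt, Hd; lra.
  + specialize (HK0 z ltac:(lra)); rewrite Rminus_0_r in HK0.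
    rewrite <- Rmult_minus_distr_l, !Rabs_mult, (Rabs_pos_eq y) by exact Hy0.
    assert (y * Rabs (cn n - c) <= M * S).
    { unfold y; rewrite (Rmult_comm (INR n) x), Rmult_assoc.
      apply Rmult_le_compat; try lra.
      apply Rmult_le_pos; [lra | apply Rabs_pos]. }
    apply Rle_lt_trans with (eps / (M * S + 1) * (M * S)).
    * apply Rmult_le_compat; try lra; [apply Rabs_pos |].
      apply Rmult_le_pos; [lra | apply Rabs_pos].
    * apply Rlt_le_trans with (eps / (M * S + 1) * (M * S + 1)); [nra |].
      right; field; lra.
- apply Hdelta; try nra.
  rewrite <- Rmult_minus_distr_l, Rabs_mult, (Rabs_pos_eq y) by exact Hy0.
  apply Rle_lt_trans with (2 := HcY).
  apply Rmult_le_compat_r; [apply Rabs_pos | lra].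
Qed.

Lemma is_lim_seq_derive_0 (g : R -> R) (s : R) :
  is_derive g 0 s -> is_lim_seq (fun n => INR n * (g (/ INR n) - g 0)) s.
Proof.
intros Hg; apply is_lim_seq_spec; intros eps.
apply is_derive_Reals in Hg; destruct (Hg eps (cond_pos eps)) as [d Hd].
destruct (INR_unbounded (/ d)) as [N HN].
exists (S N); intros n Hn.
assert (Hnd : / d < INR n) by (apply Rlt_le_trans with (1 := HN), le_INR; lia).
assert (Hdp : 0 < / d) by apply Rinv_0_lt_compat, cond_pos.
specialize (Hd (/ INR n)); rewrite Rplus_0_l in Hd.
replace (INR n * (g (/ INR n) - g 0)) with ((g (/ INR n) - g 0) / / INR n) by (field; lra).
apply Hd.
- apply Rinv_neq_0_compat; lra.
- rewrite Rabs_pos_eq by (apply Rlt_le, Rinv_0_lt_compat; lra).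
  rewrite <- (Rinv_inv d); apply Rinv_lt_contravar; [nra | exact Hnd].
Qed.

(* [A1 (h t) * A2 (y * h t) / (A1 (h 1) * A2 (y * h 1))] is the probability generating
   function, at [t], of the weights of the operator at [y = n x]. *)
Lemma brenke_exponential_moment (r : R) (A1 A2 h : R -> R) (a1 a2 hc : nat -> R)
    (p : nat -> R -> R) (s M : R) :
  generalized_brenke r A1 A2 h a1 a2 hc p ->
  is_lim (fun y => Derive A2 y / A2 y) p_infty 1 -> 0 <= M ->
  forall eps : R, 0 < eps -> exists N : nat, forall (n : nat) (x : R), (N <= n)%nat ->
    0 <= x <= M ->
    exp (s * / INR n) < r /\
    Rabs (exp (- (s * x)) *
      (A1 (h (exp (s * / INR n))) * A2 (INR n * x * h (exp (s * / INR n)))) /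
      (A1 (h 1) * A2 (INR n * x * h 1)) - 1) < eps.
Proof.
intros Hp Hlim HM eps Heps.
pose proof (gb_radius _ _ _ _ _ _ _ _ Hp) as Hr.
pose proof (gb_A1_pos _ _ _ _ _ _ _ _ Hp) as HA1.
pose proof (gb_A2_pos _ _ _ _ _ _ _ _ Hp) as HA2.
pose proof (brenke_h1_pos _ _ _ _ _ _ _ _ Hp) as Hh1.
pose proof (fun z => brenke_A2_derivable _ _ _ _ _ _ _ _ z Hp) as HdA2.
(* The ratio of [A2] at [y * h t] and at [y * h 1] is [exp] of the increment of [L] plus
   [y * (h t - h 1)]. *)
set (L := fun z => ln (A2 z) - z).
assert (HdL : forall z, 0 <= z -> is_derive L z (Derive A2 z / A2 z - 1)).
{ intros z Hz; unfold L; auto_derive.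
  - repeat split; [apply HdA2, Hz | apply HA2].
  - change (fun x => A2 x) with A2; field; apply Rgt_not_eq, HA2. }
assert (HlimL : is_lim (Derive L) p_infty 0).
{ apply (is_lim_ext_loc (fun y => Derive A2 y / A2 y - 1)).
  - exists 0; intros y Hy; symmetry; apply is_derive_unique, HdL; lra.
  - rewrite <- (Rminus_diag 1); apply (is_lim_minus' _ (fun _ => 1)); [exact Hlim |].
    apply is_lim_const. }
(* The limit is the derivative at 0 of [h (exp (s * u))], equal to [s] by the chain rule, since [h]
   has derivative 1 at 1. *)
assert (Hexp : is_lim_seq (fun n => INR n * (h (exp (s * / INR n)) - h 1)) s).
{ replace (h 1) with (h (exp (s * 0))) by (rewrite Rmult_0_r, exp_0; reflexivity).
  apply (is_lim_seq_derive_0 (fun u => h (exp (s * u)))).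
  evar_last.
  - apply (is_derive_comp h (fun u => exp (s * u)) 0 1 s).
    + rewrite Rmult_0_r, exp_0; apply (gb_dh_1 _ _ _ _ _ _ _ _ Hp).
    + auto_derive; [exact I | rewrite Rmult_0_r, exp_0; ring].
  - exact (Rmult_1_r s). }
assert (Hone : is_lim_seq (fun n => exp (s * / INR n)) 1).
{ rewrite <- exp_0, <- (Rmult_0_r s).
  apply (is_lim_seq_continuous (fun u => exp (s * u))).
  - apply ex_derive_continuity_pt; auto_derive; exact I.
  - apply (is_lim_seq_inv _ p_infty); [apply is_lim_seq_INR | discriminate]. }
assert (HA : is_lim_seq (fun n => ln (A1 (h (exp (s * / INR n))) / A1 (h 1))) 0).
{ evar_last.
  2: apply f_equal, (eq_trans (f_equal ln (Rdiv_diag _ (Rgt_not_eq _ _ (HA1 (h 1))))) ln_1).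
  apply (is_lim_seq_continuous (fun t => ln (A1 (h t) / A1 (h 1))) _ 1); [| exact Hone].
  apply ex_derive_continuity_pt.
  (* No bound [h 1 < r] is available for the series of [A1], so differentiability of [A1 (h t)] at 1
     is read off the generating function at [x = 0], where the [A2] factor is constant. *)
  apply (ex_derive_ext (fun t => ln ((A1 (h t) * A2 (0 * h t)) / (A1 (h 1) * A2 0)))).
  - intros t; rewrite Rmult_0_l; simpl; f_equal.
    pose proof (HA1 (h 1)); pose proof (HA2 0); field; lra.
  - apply (ex_derive_comp (fun w => ln (w / (A1 (h 1) * A2 0)))).
    + auto_derive; rewrite Rmult_0_l; apply Rdiv_lt_0_compat; apply Rmult_lt_0_compat; auto.
    + eexists; apply (is_derive_pseries r (fun k => p k 0)
        (fun t => A1 (h t) * A2 (0 * h t))); [| rewrite Rabs_R1; lra].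
      intros; apply (gb_generating _ _ _ _ _ _ _ _ Hp); [lra | assumption]. }
assert (Hexpc : continuity_pt exp 0)
  by (apply ex_derive_continuity_pt; auto_derive; exact I).
destruct (proj1 (continuity_pt_locally exp 0) Hexpc (mkposreal _ Heps)) as [eta Heta].
assert (Heta3 : 0 < eta / 3) by (pose proof (cond_pos eta); lra).
assert (HetaM : 0 < eta / 3 / (M + 1)) by (apply Rdiv_lt_0_compat; lra).
destruct (increment_cv_0 L (h 1) s M (fun n => h (exp (s * / INR n)))) with (eps := eta / 3)
  as [N1 HN1]; try assumption.
{ intros z Hz; eexists; apply HdL, Hz. }
apply is_lim_seq_spec in Hexp; destruct (Hexp (mkposreal _ HetaM)) as [N2 HN2].
apply is_lim_seq_spec in HA; destruct (HA (mkposreal _ Heta3)) as [N3 HN3].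
assert (Hr1 : 0 < r - 1) by lra.
apply is_lim_seq_spec in Hone; destruct (Hone (mkposreal _ Hr1)) as [N4 HN4].
simpl in HN1, HN2, HN3, HN4, Heta.
exists (N1 + N2 + N3 + N4)%nat; intros n x Hn Hx.
specialize (HN1 n x ltac:(lia) Hx); specialize (HN2 n ltac:(lia)).
specialize (HN3 n ltac:(lia)); specialize (HN4 n ltac:(lia)).
set (t := exp (s * / INR n)) in *.
split; [apply Rabs_def2 in HN4; lra |].
rewrite Rminus_0_r in HN3.
(* [theta] is the logarithm of the normalised moment; each of its three summands is at most
   [eta / 3] in absolute value. *)
set (theta := ln (A1 (h t) / A1 (h 1)) + (L (INR n * x * h t) - L (INR n * x * h 1)) +
  x * (INR n * (h t - h 1) - s)).
replace (exp (- (s * x)) * (A1 (h t) * A2 (INR n * x * h t)) /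
  (A1 (h 1) * A2 (INR n * x * h 1))) with (exp theta).
- rewrite <- exp_0; apply Heta; change (Rabs (theta - 0) < eta); rewrite Rminus_0_r.
  assert (Rabs (x * (INR n * (h t - h 1) - s)) <= eta / 3).
  { rewrite Rabs_mult, (Rabs_pos_eq x) by lra.
    apply Rle_trans with ((M + 1) * (eta / 3 / (M + 1))).
    - apply Rmult_le_compat; try lra; apply Rabs_pos.
    - right; field; lra. }
  unfold theta; eapply Rle_lt_trans; [apply Rabs_triang |].
  eapply Rle_lt_trans; [apply Rplus_le_compat_r, Rabs_triang |]; lra.
- replace theta with (- (s * x) + (ln (A1 (h t)) + ln (A2 (INR n * x * h t))) -
    (ln (A1 (h 1)) + ln (A2 (INR n * x * h 1)))).
  + rewrite <- !ln_mult by auto; unfold Rminus; rewrite !exp_plus, (exp_Ropp (ln _)).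
    rewrite !exp_ln by (apply Rmult_lt_0_compat; auto); reflexivity.
  + unfold theta, L; rewrite ln_div by auto; ring.
Qed.

(** * Weighted means and quadratic domination *)

Lemma exp_INR_mult (c : R) (k : nat) : exp (INR k * c) = exp c ^ k.
Proof.
induction k as [| k IH].
- simpl; rewrite Rmult_0_l; apply exp_0.
- rewrite S_INR, Rmult_plus_distr_r, Rmult_1_l, exp_plus, IH; simpl; ring.
Qed.

(** The bracket equals [(exp w - exp (- w)) ^ 2] at [w = v / 2], which accounts for the factor 4.
    For [w >= 0], [exp w >= 1 + w] and [exp (- w) <= 1] bound the difference below by [w]; evenness
    covers [w < 0]. *)
Lemma sqr_le_exp (v : R) : v ^ 2 <= 4 * (exp v + exp (- v) - 2).
Proof.
assert (Hpos : forall w, 0 <= w -> w ^ 2 <= (exp w - exp (- w)) ^ 2).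
{ intros w Hw; apply pow_incr; split; [exact Hw |].
  pose proof (exp_ineq1_le w) as H1.
  assert (H2 : exp (- w) <= / (1 + w)) by (rewrite exp_Ropp; apply Rinv_le_contravar; lra).
  assert (H3 : / (1 + w) <= 1) by (rewrite <- Rinv_1; apply Rinv_le_contravar; lra).
  lra. }
assert (Hw : (v / 2) ^ 2 <= (exp (v / 2) - exp (- (v / 2))) ^ 2).
{ destruct (Rle_dec 0 (v / 2)) as [H | H]; [apply Hpos, H |].
  specialize (Hpos (- (v / 2)) ltac:(lra)); rewrite Ropp_involutive in Hpos; nra. }
replace (exp v) with (exp (v / 2) * exp (v / 2)) by (rewrite <- exp_plus; f_equal; field).
replace (exp (- v)) with (exp (- (v / 2)) * exp (- (v / 2)))
  by (rewrite <- exp_plus; f_equal; field).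
assert (exp (v / 2) * exp (- (v / 2)) = 1)
  by (rewrite <- exp_plus, Rplus_opp_r; apply exp_0).
nra.
Qed.

(** Subtracting [c] from [g] leaves a series dominated by [w k * b k]. Besides the error estimate,
    it is used with [c = 0] for convergence alone. *)
Lemma weighted_mean_dist_le (w g b : nat -> R) (c S B : R) :
  (forall k, 0 <= w k) -> 0 < S -> is_series w S ->
  (forall k, Rabs (g k - c) <= b k) -> is_series (fun k => w k * b k) B ->
  ex_series (fun k => w k * g k) /\ Rabs (1 / S * Series (fun k => w k * g k) - c) <= B / S.
Proof.
intros Hw HS Sw Hg Sb.
assert (Hle : forall k, Rabs (w k * (g k - c)) <= w k * b k).
{ intros k; rewrite Rabs_mult, (Rabs_pos_eq (w k)) by apply Hw.
  apply Rmult_le_compat_l; [apply Hw | apply Hg]. }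
assert (Eb : ex_series (fun k => w k * b k)) by (eexists; exact Sb).
assert (Ea : ex_series (fun k => Rabs (w k * (g k - c)))).
{ apply (ex_series_le (V := R_CompleteNormedModule) _ (fun k => w k * b k)); [| exact Eb].
  intros k; change (Rabs (Rabs (w k * (g k - c))) <= w k * b k).
  rewrite Rabs_Rabsolu; apply Hle. }
destruct (ex_series_Rabs _ Ea) as [D HD].
assert (HDB : Rabs D <= B).
{ rewrite <- (is_series_unique _ _ HD), <- (is_series_unique _ _ Sb).
  eapply Rle_trans; [apply Series_Rabs, Ea |].
  apply Series_le; [| exact Eb].
  intros k; split; [apply Rabs_pos | apply Hle]. }
assert (Hsum : is_series (fun k => w k * g k) (D + S * c)).
{ apply (is_series_ext (fun k => w k * (g k - c) + w k * c)).
  - intros k; simpl; ring.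
  - apply (is_series_plus (V := R_NormedModule)); [exact HD | apply is_series_scal_r, Sw]. }
split; [eexists; exact Hsum |].
rewrite (is_series_unique _ _ Hsum).
replace (1 / S * (D + S * c) - c) with (D / S) by (field; lra).
rewrite Rabs_div, (Rabs_pos_eq S) by lra.
apply Rmult_le_compat_r; [apply Rlt_le, Rinv_0_lt_compat, HS | exact HDB].
Qed.

(** Reflection turns one-sided continuity at 0 into two-sided continuity, as Heine's theorem is
    applied on the whole line's notion; [Rabs] takes values in the half-line, so the restricted
    neighbourhood filter suffices. *)
Lemma continuity_pt_Rabs_ext (f : R -> R) :
  continuous_on (fun x => 0 <= x) f -> forall x, continuity_pt (fun t => f (Rabs t)) x.
Proof.
intros Hf x; apply continuity_pt_filterlim.
apply (filterlim_comp _ _ _ Rabs f (locally x) (within (fun y => 0 <= y) (locally (Rabs x)))).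
- intros P HP; pose proof (continuous_Rabs x _ HP) as H.
  unfold filtermap in *; revert H; apply filter_imp.
  intros t Ht; apply Ht, Rabs_pos.
- apply Hf, Rabs_pos.
Qed.

(** Beyond some [X] the quotient stays within 1 of its limit [l]; on [[0, Rmax 0 X]] continuity
    gives a maximum. The constant adds the two bounds. *)
Lemma class_E_bound (f : R -> R) :
  (forall x, continuity_pt f x) -> class_E f ->
  exists C : R, 0 <= C /\ forall u, 0 <= u -> Rabs (f u) <= C * (1 + u ^ 2).
Proof.
intros Hf [l Hl].
apply is_lim_spec in Hl; destruct (Hl (mkposreal 1 Rlt_0_1)) as [X HX]; cbn [pos] in HX.
destruct (continuity_ab_maj (fun u => Rabs (f u)) 0 (Rmax 0 X)) as (m & Hm & _).
{ apply Rmax_l. }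
{ intros c _; apply (continuity_pt_comp f Rabs); [apply Hf | apply Rcontinuity_abs]. }
exists (Rabs (f m) + (Rabs l + 1)).
pose proof (Rabs_pos (f m)); pose proof (Rabs_pos l).
split; [lra |]; intros u Hu; pose proof (pow2_ge_0 u).
destruct (Rle_lt_dec u X) as [Hle | Hlt].
- specialize (Hm u); pose proof (Rmax_r 0 X); specialize (Hm ltac:(lra)); simpl in Hm; nra.
- specialize (HX u Hlt).
  assert (Hq : Rabs (f u / (1 + u ^ 2)) <= Rabs l + 1).
  { pose proof (Rabs_triang_inv (f u / (1 + u ^ 2)) l); lra. }
  rewrite Rabs_div, (Rabs_pos_eq (1 + u ^ 2)) in Hq by lra.
  apply Rmult_le_compat_r with (r := 1 + u ^ 2) in Hq; [| lra].
  unfold Rdiv in Hq; rewrite Rmult_assoc, Rinv_l in Hq by lra; nra.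
Qed.

(** For [u] near [x], uniform continuity on [[0, M + 1]] gives [eps]; for [e <= Rabs (u - x)], the
    growth bound is absorbed because [(u - x) ^ 2 / e ^ 2 >= 1]. *)
Lemma quadratic_modulus (f : R -> R) (C M eps : R) :
  (forall x, continuity_pt f x) -> 0 <= C ->
  (forall u, 0 <= u -> Rabs (f u) <= C * (1 + u ^ 2)) -> 0 < eps ->
  exists D : R, 0 <= D /\ forall x u, 0 <= x <= M -> 0 <= u ->
    Rabs (f u - f x) <= eps + D * (u - x) ^ 2.
Proof.
intros Hf HC Hb Heps.
destruct (Heine f _ (compact_P3 0 (M + 1))) with (eps := mkposreal _ Heps) as [d Hd].
{ intros x _; apply Hf. }
simpl in Hd.
set (e := Rmin d 1).
assert (He : 0 < e /\ e <= d /\ e <= 1).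
{ repeat split; [apply Rmin_glb_lt; [apply cond_pos | lra] | apply Rmin_l | apply Rmin_r]. }
assert (He2 : 0 < e ^ 2) by (apply pow_lt; lra).
set (Q := C * (2 + 3 * M ^ 2)).
assert (HQ : 0 <= Q) by (apply Rmult_le_pos; [lra | pose proof (pow2_ge_0 M); lra]).
exists (Q / e ^ 2 + 2 * C).
assert (HQe : 0 <= Q / e ^ 2) by (apply Rdiv_le_0_compat; lra).
split; [lra |]; intros x u Hx Hu.
pose proof (pow2_ge_0 (u - x)) as Hsq.
destruct (Rlt_le_dec (Rabs (u - x)) e) as [Hlt | Hle].
- assert (Rabs (f u - f x) < eps).
  { pose proof (Rabs_def2 _ _ Hlt); apply Hd; lra. }
  assert (0 <= (Q / e ^ 2 + 2 * C) * (u - x) ^ 2) by (apply Rmult_le_pos; lra).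
  lra.
- assert (Hee : e ^ 2 <= (u - x) ^ 2) by (rewrite <- (pow2_abs (u - x)); apply pow_incr; lra).
  assert (HQ2 : Q <= Q / e ^ 2 * (u - x) ^ 2).
  { apply Rle_trans with (Q / e ^ 2 * e ^ 2); [right; field; lra |].
    apply Rmult_le_compat_l; assumption. }
  pose proof (Hb u Hu) as Bu; pose proof (Hb x (proj1 Hx)) as Bx.
  assert (Hux : 1 + u ^ 2 + (1 + x ^ 2) <= 2 + 3 * M ^ 2 + 2 * (u - x) ^ 2).
  { assert (x ^ 2 <= M ^ 2) by (apply pow_incr; lra).
    (* This square is the gap in [u ^ 2 <= 2 * (u - x) ^ 2 + 2 * x ^ 2]. *)
    pose proof (pow2_ge_0 (u - 2 * x)); nra. }
  apply Rmult_le_compat_l with (r := C) in Hux; [| exact HC].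
  pose proof (Rabs_triang (f u) (- f x)) as T; rewrite Rabs_Ropp in T.
  unfold Rminus at 1; unfold Q in *; lra.
Qed.

(** * Summability and a quantitative estimate for the operator *)

Lemma brenke_is_series (r : R) (A1 A2 h : R -> R) (a1 a2 hc : nat -> R)
    (p : nat -> R -> R) (y t : R) :
  generalized_brenke r A1 A2 h a1 a2 hc p -> 0 <= y -> 0 < t < r ->
  is_series (fun k => p k y * t ^ k) (A1 (h t) * A2 (y * h t)).
Proof.
intros Hp Hy Ht; apply is_pseries_R, (gb_generating _ _ _ _ _ _ _ _ Hp); [exact Hy |].
rewrite Rabs_pos_eq; lra.
Qed.

Lemma brenke_is_series_1 (r : R) (A1 A2 h : R -> R) (a1 a2 hc : nat -> R)
    (p : nat -> R -> R) (y : R) :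
  generalized_brenke r A1 A2 h a1 a2 hc p -> 0 <= y ->
  is_series (fun k => p k y) (A1 (h 1) * A2 (y * h 1)).
Proof.
intros Hp Hy; pose proof (gb_radius _ _ _ _ _ _ _ _ Hp).
apply (is_series_ext (fun k => p k y * 1 ^ k)).
- intros k; rewrite pow1; apply Rmult_1_r.
- apply (brenke_is_series _ _ _ _ _ _ _ _ _ _ Hp Hy); lra.
Qed.

(** Quadratic growth of [f] is dominated by a geometric sequence [rho ^ k] with [1 < rho < r], and
    the generating series converges at [rho]. *)
Lemma stancu_ex_series (r : R) (A1 A2 h : R -> R) (a1 a2 hc : nat -> R)
    (p : nat -> R -> R) (nu1 nu2 C : R) (f : R -> R) (n : nat) (x : R) :
  generalized_brenke r A1 A2 h a1 a2 hc p -> 0 <= nu1 -> 0 <= nu2 -> 0 <= C ->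
  (forall u, 0 <= u -> Rabs (f u) <= C * (1 + u ^ 2)) -> (1 <= n)%nat -> 0 <= x ->
  ex_series (stancu_term p nu1 nu2 n f x).
Proof.
intros Hp Hnu1 Hnu2 HC Hf Hn Hx.
pose proof (gb_radius _ _ _ _ _ _ _ _ Hp) as Hr.
assert (Hy : 0 <= INR n * x) by (apply Rmult_le_pos; [apply pos_INR | exact Hx]).
set (rho := (1 + r) / 2); set (c := ln rho).
assert (Hc : 0 < c) by (rewrite <- ln_1; apply ln_increasing; unfold rho; lra).
assert (Hec : exp c = rho) by (apply exp_ln; unfold rho; lra).
assert (Hc2 : 0 < c ^ 2) by (apply pow_lt, Hc).
(* From [(INR k + nu1) ^ 2 <= 2 * nu1 ^ 2 + 2 * INR k ^ 2] and [sqr_le_exp] at [INR k * c], which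
   bounds [INR k ^ 2] by [4 / c ^ 2 * rho ^ k]. *)
set (a := C * (1 + 2 * nu1 ^ 2)); set (b := C * (8 / c ^ 2)).
destruct (weighted_mean_dist_le (fun k => p k (INR n * x))
  (fun k => f ((INR k + nu1) / (INR n + nu2))) (fun k => a + b * rho ^ k) 0
  (A1 (h 1) * A2 (INR n * x * h 1))
  ((A1 (h 1) * A2 (INR n * x * h 1)) * a + (A1 (h rho) * A2 (INR n * x * h rho)) * b))
  as [H _]; [| | | | | exact H].
- intros k; apply (gb_p_nonneg _ _ _ _ _ _ _ _ Hp), Hy.
- apply Rmult_lt_0_compat;
    [apply (gb_A1_pos _ _ _ _ _ _ _ _ Hp) | apply (gb_A2_pos _ _ _ _ _ _ _ _ Hp)].
- apply (brenke_is_series_1 _ _ _ _ _ _ _ _ _ Hp Hy).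
- intros k; rewrite Rminus_0_r.
  pose proof (pos_INR k) as Hk.
  assert (Hn1 : 1 <= INR n) by (apply (le_INR 1), Hn).
  set (u := (INR k + nu1) / (INR n + nu2)).
  assert (Hu : 0 <= u) by (apply Rdiv_le_0_compat; lra).
  assert (Huk : u <= INR k + nu1).
  { apply Rle_div_l; [lra |]; nra. }
  assert (Hu2 : u ^ 2 <= (INR k + nu1) ^ 2) by (apply pow_incr; lra).
  assert (Hk2 : INR k ^ 2 <= 4 / c ^ 2 * rho ^ k).
  { pose proof (sqr_le_exp (INR k * c)) as E.
    rewrite exp_INR_mult, Hec in E.
    assert (exp (- (INR k * c)) <= 1).
    { pose proof (exp_ineq1_le (INR k * c)).
      pose proof (Rmult_le_pos _ _ Hk (Rlt_le _ _ Hc)).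
      rewrite exp_Ropp, <- Rinv_1; apply Rinv_le_contravar; lra. }
    apply Rmult_le_reg_r with (c ^ 2); [exact Hc2 |].
    replace (4 / c ^ 2 * rho ^ k * c ^ 2) with (4 * rho ^ k) by (field; lra).
    rewrite <- Rpow_mult_distr; lra. }
  apply Rle_trans with (1 := Hf u Hu).
  replace (a + b * rho ^ k) with (C * (1 + 2 * nu1 ^ 2 + 2 * (4 / c ^ 2 * rho ^ k)))
    by (unfold a, b; field; lra).
  apply Rmult_le_compat_l; [exact HC |].
  pose proof (pow2_ge_0 (INR k - nu1)); nra.
- apply (is_series_ext (fun k => p k (INR n * x) * a + p k (INR n * x) * rho ^ k * b)).
  + intros k; simpl; ring.
  + apply (is_series_plus (V := R_NormedModule)); apply is_series_scal_r.
    * apply (brenke_is_series_1 _ _ _ _ _ _ _ _ _ Hp Hy).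
    * apply (brenke_is_series _ _ _ _ _ _ _ _ _ _ Hp Hy); unfold rho; lra.
Qed.

(* Korovkin's argument, with the quadratic test function [(u - x)^2] dominated by
   [4 (exp v + exp (- v) - 2)] at [v = k / n - x]. *)
Lemma stancu_dist_le (r : R) (A1 A2 h : R -> R) (a1 a2 hc : nat -> R)
    (p : nat -> R -> R) (nu1 nu2 M e D : R) (f : R -> R) (n : nat) (x : R) :
  let G := fun t => A1 (h t) * A2 (INR n * x * h t) in
  let m := fun s => exp (- (s * x)) * G (exp (s * / INR n)) / G 1 in
  generalized_brenke r A1 A2 h a1 a2 hc p -> 0 <= nu1 -> 0 <= nu2 -> 0 <= D ->
  (forall u, 0 <= u -> Rabs (f u - f x) <= e + D * (u - x) ^ 2) ->
  (1 <= n)%nat -> 0 <= x <= M -> exp (1 * / INR n) < r -> exp (- 1 * / INR n) < r ->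
  Rabs (stancu_op A1 A2 h p nu1 nu2 n f x - f x) <=
    e + 2 * D * (nu1 + nu2 * M) ^ 2 / INR n + 8 * D * ((m 1 - 1) + (m (- 1) - 1)).
Proof.
intros G m Hp Hnu1 Hnu2 HD Hf Hn Hx Hr1 Hr2.
assert (Hy : 0 <= INR n * x) by (apply Rmult_le_pos; [apply pos_INR | apply Hx]).
assert (HG : forall t, 0 < G t).
{ intros t; apply Rmult_lt_0_compat;
    [apply (gb_A1_pos _ _ _ _ _ _ _ _ Hp) | apply (gb_A2_pos _ _ _ _ _ _ _ _ Hp)]. }
assert (Hn1 : 1 <= INR n) by (apply (le_INR 1), Hn).
set (F := nu1 + nu2 * M).
(* Coefficients of 1, [exp (k / n)] and [exp (- k / n)] in the dominating sequence; [- 16 * D] is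
   [8 * D] times the [- 2] of [sqr_le_exp]. *)
set (c0 := e + 2 * D * F ^ 2 / INR n - 16 * D).
set (cp := 8 * D * exp (- (1 * x))); set (cm := 8 * D * exp (- (- 1 * x))).
destruct (weighted_mean_dist_le (fun k => p k (INR n * x))
  (fun k => f ((INR k + nu1) / (INR n + nu2)))
  (fun k => c0 + exp (1 * / INR n) ^ k * cp + exp (- 1 * / INR n) ^ k * cm) (f x) (G 1)
  (G 1 * c0 + G (exp (1 * / INR n)) * cp + G (exp (- 1 * / INR n)) * cm)) as [_ H].
- intros k; apply (gb_p_nonneg _ _ _ _ _ _ _ _ Hp), Hy.
- apply HG.
- apply (brenke_is_series_1 _ _ _ _ _ _ _ _ _ Hp Hy).
- intros k; pose proof (pos_INR k) as Hk.
  set (u := (INR k + nu1) / (INR n + nu2)).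
  assert (Hu : 0 <= u) by (apply Rdiv_le_0_compat; lra).
  apply Rle_trans with (1 := Hf u Hu).
  set (v := INR k / INR n - x).
  assert (Huv : (u - x) ^ 2 <= 2 * v ^ 2 + 2 * (F ^ 2 / INR n)).
  (* The Stancu node is a contraction [q] of [v] plus a shift [b], and [(q * v + b) ^ 2 <= 2 * (q *
     v) ^ 2 + 2 * b ^ 2]. *)
  { set (q := INR n / (INR n + nu2)); set (b := (nu1 - nu2 * x) / (INR n + nu2)).
    replace (u - x) with (q * v + b) by (unfold u, v, q, b; field; lra).
    assert (Hq : 0 <= q <= 1).
    { split; [apply Rdiv_le_0_compat; lra | apply Rle_div_l; lra]. }
    assert (Hb : b ^ 2 <= F ^ 2 / INR n).
    (* One factor [1 / INR n] is given up, since [INR n >= 1]. *)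
    { apply Rle_trans with ((F / INR n) ^ 2).
      - rewrite <- (pow2_abs b); apply pow_incr; split; [apply Rabs_pos |].
        unfold b; rewrite Rabs_div, (Rabs_pos_eq (INR n + nu2)) by lra.
        assert (0 <= nu2 * x <= nu2 * M) by nra.
        apply Rmult_le_compat.
        + apply Rabs_pos.
        + apply Rlt_le, Rinv_0_lt_compat; lra.
        + unfold F; apply Rabs_le; lra.
        + apply Rinv_le_contravar; lra.
      - unfold Rdiv; rewrite Rpow_mult_distr; apply Rmult_le_compat_l; [apply pow2_ge_0 |].
        rewrite pow_inv; apply Rinv_le_contravar; nra. }
    pose proof (pow2_ge_0 (q * v - b)).
    assert (q ^ 2 * v ^ 2 <= 1 * v ^ 2)
      by (apply Rmult_le_compat_r; [apply pow2_ge_0 | nra]).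
    nra. }
  assert (Hexp : v ^ 2 <= 4 * (exp (- (1 * x)) * exp (1 * / INR n) ^ k +
    exp (- (- 1 * x)) * exp (- 1 * / INR n) ^ k - 2)).
  { rewrite <- !exp_INR_mult, <- !exp_plus.
    replace (- (1 * x) + INR k * (1 * / INR n)) with v by (unfold v; field; lra).
    replace (- (- 1 * x) + INR k * (- 1 * / INR n)) with (- v) by (unfold v; field; lra).
    apply sqr_le_exp. }
  unfold c0, cp, cm.
  apply Rle_trans with (e + D * (2 * (4 * (exp (- (1 * x)) * exp (1 * / INR n) ^ k +
    exp (- (- 1 * x)) * exp (- 1 * / INR n) ^ k - 2)) + 2 * (F ^ 2 / INR n))).
  + apply Rplus_le_compat_l, Rmult_le_compat_l; lra.
  + right; field; lra.
- apply (is_series_ext (fun k => p k (INR n * x) * c0 +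
    p k (INR n * x) * exp (1 * / INR n) ^ k * cp +
    p k (INR n * x) * exp (- 1 * / INR n) ^ k * cm)).
  + intros k; simpl; ring.
  + pose proof (exp_pos (1 * / INR n)); pose proof (exp_pos (- 1 * / INR n)).
    repeat apply (is_series_plus (V := R_NormedModule)); apply is_series_scal_r.
    * apply (brenke_is_series_1 _ _ _ _ _ _ _ _ _ Hp Hy).
    * apply (brenke_is_series _ _ _ _ _ _ _ _ _ _ Hp Hy); lra.
    * apply (brenke_is_series _ _ _ _ _ _ _ _ _ _ Hp Hy); lra.
- eapply Rle_trans; [exact H |].
  pose proof (HG 1); right; unfold c0, cp, cm, m, F; field; lra.
Qed.

(** * Uniform convergence on compact sets *)

Theorem theorem2p1 (r : R) (A1 A2 h : R -> R) (a1 a2 hc : nat -> R)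
    (p : nat -> R -> R) (nu1 nu2 : R) (f : R -> R)
    (Hp : generalized_brenke r A1 A2 h a1 a2 hc p)
    (Hnu1 : 0 <= nu1) (Hnu2 : 0 <= nu2)
    (HA2' : is_lim (fun y => Derive A2 y / A2 y) p_infty 1)
    (HA2'' : is_lim (fun y => Derive_n A2 2 y / A2 y) p_infty 1)
    (Hf : continuous_on (fun x => 0 <= x) f)
    (HE : class_E f) :
  (forall (n : nat) (x : R), (1 <= n)%nat -> 0 <= x ->
     ex_series (stancu_term p nu1 nu2 n f x)) /\
  (forall K : R -> Prop, compact K -> (forall x : R, K x -> 0 <= x) ->
     unif_cv_on K (fun n => stancu_op A1 A2 h p nu1 nu2 n f) f).
Proof.
pose proof (continuity_pt_Rabs_ext f Hf) as Hg.
set (g := fun x => f (Rabs x)) in *.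
assert (Hfg : forall x, 0 <= x -> g x = f x)
  by (intros x Hx; unfold g; rewrite Rabs_pos_eq by exact Hx; reflexivity).
assert (HEg : class_E g).
{ destruct HE as [l Hl]; exists l; revert Hl; apply is_lim_ext_loc.
  exists 0; intros x Hx; rewrite Hfg by lra; reflexivity. }
destruct (class_E_bound g Hg HEg) as (C & HC & Hb).
split.
(* [Series] is total, so this convergence is what gives the operator its intended meaning. *)
{ intros n x Hn Hx.
  apply (stancu_ex_series r A1 A2 h a1 a2 hc p nu1 nu2 C f n x); try assumption.
  intros u Hu; rewrite <- Hfg by exact Hu; apply Hb, Hu. }
intros K HK HK0 eps.
destruct (compact_P1 K HK) as (m0 & M0 & HM0).
(* Truncation at 0 covers an empty [K], whose bound [M0] may be negative. *)
set (M := Rmax 0 M0).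
assert (HM : 0 <= M) by apply Rmax_l.
pose proof (cond_pos eps) as Heps.
destruct (quadratic_modulus g C M (eps / 4) Hg HC Hb) as (D & HD & Hmod); [lra |].
(* The two moment errors enter with factor [8 * D], so together they cost at most
   [16 * (eps / 64) = eps / 4]; [D + 1] keeps the denominator positive. *)
assert (Heta : 0 < eps / (64 * (D + 1))) by (apply Rdiv_lt_0_compat; lra).
set (eta := eps / (64 * (D + 1))) in *.
assert (HDeta : D * eta <= eps / 64).
{ apply Rle_trans with ((D + 1) * eta); [nra |]; right; unfold eta; field; lra. }
destruct (brenke_exponential_moment _ _ _ _ _ _ _ _ 1 M Hp HA2' HM eta Heta) as [N1 HN1].
destruct (brenke_exponential_moment _ _ _ _ _ _ _ _ (- 1) M Hp HA2' HM eta Heta)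
  as [N2 HN2].
set (Q := 2 * D * (nu1 + nu2 * M) ^ 2).
assert (HQ : 0 <= Q) by (apply Rmult_le_pos; [lra | apply pow2_ge_0]).
destruct (INR_unbounded (Q / (eps / 4))) as [N3 HN3].
exists (N1 + N2 + N3 + 1)%nat; intros n x Hn HKx.
assert (Hx : 0 <= x <= M).
{ split; [apply HK0, HKx |].
  apply Rle_trans with M0; [apply HM0, HKx | apply Rmax_r]. }
destruct (HN1 n x ltac:(lia) Hx) as [Hr1 E1]; destruct (HN2 n x ltac:(lia) Hx) as [Hr2 E2].
assert (Hn1 : 1 <= INR n) by (apply (le_INR 1); lia).
assert (HQn : Q / INR n <= eps / 4).
{ apply Rle_div_l; [lra |].
  assert (Q / (eps / 4) <= INR n)
    by (apply Rle_trans with (1 := Rlt_le _ _ HN3), le_INR; lia).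
  apply Rle_div_l in H; lra. }
assert (Hmain := fun Hmod' Hn' => stancu_dist_le r A1 A2 h a1 a2 hc p nu1 nu2 M (eps / 4) D f n x
  Hp Hnu1 Hnu2 HD Hmod' Hn' Hx Hr1 Hr2); cbv zeta in Hmain.
eapply Rle_lt_trans; [apply Hmain |].
- intros u Hu; rewrite <- (Hfg u Hu), <- (Hfg x (proj1 Hx)); apply Hmod; assumption.
- lia.
- apply Rabs_def2 in E1; apply Rabs_def2 in E2; fold Q.
  match goal with |- _ + _ + 8 * D * (?a + ?b) < _ =>
    assert (D * a <= D * eta) by (apply Rmult_le_compat_l; lra);
    assert (D * b <= D * eta) by (apply Rmult_le_compat_l; lra) end.
  lra.
Qed.
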